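(* Let $\mathbb{P}$ be a $\sigma$-finite stationary measure on $(\Omega,\mathcal{F})$. Let $\xi$ and $\eta$ be two invariant random measures on $G$ and let $T$ and $T^*$ be invariant weighted transport-kernels satisfying, for $\mathbb{P}$-a.e. $\omega\in\Omega$, $$\iint \mathbf{1}\{(s,t)\in\cdot\}\,T(\omega,s,dt)\,\xi(\omega,ds)=\iint \mathbf{1}\{(s,t)\in\cdot\}\,T^*(\omega,t,ds)\,\eta(\omega,dt)$$ (equality of measures on $G\times G$). Then for any measurable function $h:\Omega\times G\to[0,\infty)$, $$\mathbb{E}_{\mathbb{P}_\xi}\left[\int h(\theta_t,-t)\,T(0,dt)\right]=\mathbb{E}_{\mathbb{P}_\eta}\left[\int h(\theta_0,t)\,T^*(0,dt)\right].$$
   Context: $G$ is a locally compact, second countable Hausdorff topological Abelian group with neutral element $0$, Borel $\sigma$-field $\mathcal{G}$ and fixed Haar measure $\lambda$. $\mathbf{M}$ is the set of locally finite measures on $G$ (finite on compact sets), with the $\sigma$-field generated by the maps $\mu\mapsto\mu(B)$, $B\in\mathcal{G}$. $(\Omega,\mathcal{F})$ is a measurable space equipped with a measurable flow $\theta_s:\Omega\to\Omega$, $s\in G$: $(\omega,s)\mapsto\theta_s\omega$ is measurable, $\theta_0$ is the identity, and $\theta_s\circ\theta_t=\theta_{s+t}$ for all $s,t\in G$. A measure $\mathbb{P}$ on $(\Omega,\mathcal{F})$ is stationary if it is invariant under every $\theta_s$, $s\in G$. A random measure on $G$ is a measurable map $\xi:\Omega\to\mathbf{M}$, written $\xi(\omega,B):=\xi(\omega)(B)$;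 it is invariant if $\xi(\theta_s\omega,B-s)=\xi(\omega,B)$ for all $\omega\in\Omega$, $s\in G$, $B\in\mathcal{G}$. A weighted transport-kernel is a kernel $T$ from $\Omega\times G$ to $G$ such that $T(\omega,s,\cdot)$ is locally finite for all $(\omega,s)$. It is invariant if $T(\theta_t\omega,s-t,B-t)=T(\omega,s,B)$ for all $s,t\in G$, $\omega\in\Omega$, $B\in\mathcal{G}$. One writes $T(s,\cdot)$ for $T(\theta_0,s,\cdot)$, i.e. $\omega\mapsto T(\omega,s,\cdot)$. For $\sigma$-finite stationary $\mathbb{P}$ and an invariant random measure $\xi$, the Palm measure $\mathbb{P}_\xi$ of $\xi$ (with respect to $\mathbb{P}$) is the ($\sigma$-finite) measure on $(\Omega,\mathcal{F})$ given by $$\mathbb{P}_\xi(A):=\lambda(B)^{-1}\iint \mathbf{1}_A(\theta_s\omega)\mathbf{1}_B(s)\,\xi(\omega,ds)\,\mathbb{P}(d\omega),\qquad A\in\mathcal{F},$$ for any $B\in\mathcal{G}$ with $0<\lambda(B)<\infty$ (the definition does not depend on $B$). $\mathbb{E}_{\mathbb{Q}}$ denotes integration with respect to a measure $\mathbb{Q}$ on $(\Omega,\mathcal{F})$; the argument $\omega$ is suppressed, e.g. $h(\theta_t,-t)$ stands for $\omega\mapsto h(\theta_t\omega,-t)$. *)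

(* Defs.v *)
From HB Require Import structures.
From mathcomp Require Import all_boot all_order all_algebra.
From mathcomp Require Import all_classical all_reals all_analysis.
From mathcomp Require Import measurable_realfun.

Set Implicit Arguments.
Unset Strict Implicit.
Unset Printing Implicit Defensive.
Import Order.TTheory GRing.Theory Num.Theory.

Local Open Scope classical_set_scope.
Local Open Scope ring_scope.

HB.mixin Record isLCSCGroup G & TopologicalZmodule G := {
  lcsc_locally_compact : locally_compact [set: G] ;
  lcsc_second_countable : @second_countable G ;
  lcsc_hausdorff : hausdorff_space G }.

#[short(type="lcscGroupType")]
HB.structure Definition LCSCGroup :=
  {G of TopologicalZmodule G & isLCSCGroup G}.

(* The Borel sigma-field, attached to the sort of lcscGroupType so that every
   such group is canonically a measurableType *)
HB.instance Definition _ (G : lcscGroupType) :=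
  isPointed.Build (LCSCGroup.sort G) 0.

HB.instance Definition _ (G : lcscGroupType) :=
  @isMeasurable.Build (sigma_display (@open G)) (LCSCGroup.sort G)
    <<s (@open G) >> (@sigma_algebra0 _ setT (@open G))
    (@sigma_algebraC _ (@open G)) (@sigma_algebra_bigcup _ setT (@open G)).

Definition translate (G : zmodType) (B : set G) (t : G) : set G :=
  [set b - t | b in B].

Definition locally_finite (G : topologicalType) (R : realType)
    (mu : set G -> \bar R) : Prop :=
  forall K, compact K -> (mu K < +oo)%E.

(* On a locally compact second countable group, a locally finite Borel measure
   is automatically regular, so that regularity is not part of the definition *)
Definition haar_measure (G : lcscGroupType) (R : realType)
    (mu : {measure set G -> \bar R}) : Prop :=
  [/\ locally_finite mu, (0 < mu [set: G])%E &
      forall (s : G) (B : set G), measurable B -> mu (translate B s) = mu B].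

Section lfmeasure.
Context (G : lcscGroupType) (R : realType).

Record lfmeasure : Type := LFMeasure {
  lfmeasure_measure :> {measure set G -> \bar R} ;
  lfmeasure_locally_finite : locally_finite lfmeasure_measure }.

HB.instance Definition _ := gen_eqMixin lfmeasure.
HB.instance Definition _ := gen_choiceMixin lfmeasure.

Let locally_finite_mzero : locally_finite (@mzero _ G R).
Proof. by move=> K _; rewrite /mzero ltry. Qed.

HB.instance Definition _ :=
  isPointed.Build lfmeasure (LFMeasure locally_finite_mzero).

Definition lfmeasure_ev (B : set G) (mu : lfmeasure) : \bar R := mu B.

Definition lfmeasure_ev_preimages : set (set lfmeasure) :=
  \bigcup_(B in measurable)
    preimage_set_system [set: lfmeasure] (lfmeasure_ev B)
      (measurable : set (set (\bar R))).

Definition lfmeasure_measurable : set (set lfmeasure) :=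
  <<s lfmeasure_ev_preimages >>.

Let lfmeasure_measurable0 : lfmeasure_measurable set0.
Proof. exact: sigma_algebra0. Qed.

Let lfmeasure_measurableC (U : set lfmeasure) :
  lfmeasure_measurable U -> lfmeasure_measurable (~` U).
Proof. exact: sigma_algebraC. Qed.

Let lfmeasure_measurableU (F : (set lfmeasure)^nat) :
  (forall i, lfmeasure_measurable (F i)) ->
  lfmeasure_measurable (\bigcup_i F i).
Proof. exact: sigma_algebra_bigcup. Qed.

Definition lfmeasure_display : measure_display.
Proof. by constructor. Qed.

HB.instance Definition _ :=
  @isMeasurable.Build lfmeasure_display lfmeasure lfmeasure_measurable
    lfmeasure_measurable0 lfmeasure_measurableC lfmeasure_measurableU.

Lemma measurable_lfmeasure_ev (B : set G) : measurable B ->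
  measurable_fun [set: lfmeasure] (lfmeasure_ev B).
Proof.
move=> mB.
apply: (@measurability lfmeasure_display _ lfmeasure _ setT _ measurable).
  by rewrite smallest_id//; exact: sigma_algebra_measurable.
apply: subset_trans; last exact: sub_gen_smallest.
exact: (bigcup_sup mB).
Qed.

End lfmeasure.

Record measurable_flow d (G : lcscGroupType) (Omega : measurableType d) :
    Type := MeasurableFlow {
  flow_map :> G -> Omega -> Omega ;
  measurable_flow_map :
    measurable_fun [set: Omega * G] (fun x => flow_map x.2 x.1) ;
  flow0 : forall w, flow_map 0 w = w ;
  flowD : forall s t w, flow_map s (flow_map t w) = flow_map (s + t) w }.

Definition stationary d (G : lcscGroupType) (Omega : measurableType d)
    (theta : measurable_flow G Omega) (R : realType)
    (P : {measure set Omega -> \bar R}) : Prop :=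
  forall (s : G) (A : set Omega), measurable A -> P (theta s @^-1` A) = P A.

Notation random_measure Omega G R := {mfun Omega >-> lfmeasure G R}.

Definition invariant_random_measure d (G : lcscGroupType)
    (Omega : measurableType d) (theta : measurable_flow G Omega)
    (R : realType) (xi : random_measure Omega G R) : Prop :=
  forall (w : Omega) (s : G) (B : set G), measurable B ->
    xi (theta s w) (translate B s) = xi w B.

Definition weighted_transport_kernel d (G : lcscGroupType)
    (Omega : measurableType d) (R : realType)
    (T : R.-ker (Omega * G) ~> G) : Prop :=
  forall x, locally_finite (T x).

Definition invariant_kernel d (G : lcscGroupType)
    (Omega : measurableType d) (theta : measurable_flow G Omega)
    (R : realType) (T : R.-ker (Omega * G) ~> G) : Prop :=
  forall (s t : G) (w : Omega) (B : set G), measurable B ->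
    T (theta t w, s - t) (translate B t) = T (w, s) B.

Section lcsc_cover.
Local Open Scope ereal_scope.
Context (G : lcscGroupType).

Lemma lcsc_closed_measurable (K : set G) : closed K -> measurable K.
Proof.
move=> cK; rewrite -(setCK K); apply: measurableC.
by apply: sub_sigma_algebra; exact/closed_openC.
Qed.

Lemma lcsc_compact_cover : exists K : (set G)^nat,
  [/\ forall n, compact (K n), forall n, closed (K n) &
      \bigcup_n K n = [set: G]].
Proof.
have [B cB [Bopen Bb]] := @lcsc_second_countable G.
pose B' := [set U : set G | B U /\ precompact U].
have cB' : countable B' by apply: sub_countable cB; apply: subset_card_le => U [].
have B'T : forall x : G, exists2 U, B' U & U x.
  move=> x; have [V Vx [cV clV]] := @lcsc_locally_compact G x I.
  have {}Vx : nbhs x V.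
    have : nbhs x [set y | [set: G] y -> V y] := Vx.
    by apply: filterS => y; exact.
  have [U [BU Ux] UV] := Bb x V Vx.
  by exists U => //; split => //; exists V.
have [f] : exists f : nat -> set G, B' `<=` range f.
  have [B'0|[g]] := pfcard_geP cB'; first by exists (fun=> set0); rewrite B'0.
  by exists g; exact: 'surj_g.
move=> Bf.
exists (fun n => if pselect (B' (f n)) then closure (f n) else set0); split.
- move=> n /=; case: pselect => [[? ?]|?]; last exact: compact0.
  by rewrite -precompactE.
- by move=> n /=; case: pselect => ?; [exact: closed_closure|exact: closed0].
- apply/seteqP; split => // x _; have [U B'U Ux] := B'T x.
  have [n _ fn] := Bf _ B'U; exists n => //.
  by rewrite fn; case: pselect => // ?; exact: subset_closure.
Qed.

End lcsc_cover.

Section random_measure_integral.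
Import HBNNSimple.
Local Open Scope ereal_scope.
Context d (G : lcscGroupType) (Omega : measurableType d) (R : realType).
Variable xi : random_measure Omega G R.

Lemma measurable_random_measure (B : set G) : measurable B ->
  measurable_fun [set: Omega] (fun w => xi w B).
Proof.
move=> mB; rewrite (_ : (fun w => _) = lfmeasure_ev B \o xi)//.
by apply: measurableT_comp => //; exact: measurable_lfmeasure_ev.
Qed.

Definition random_measure_kernel (w : Omega) : {measure set G -> \bar R} :=
  xi w.

HB.instance Definition _ := isKernel.Build _ _ Omega G R
  random_measure_kernel measurable_random_measure.

Lemma measurable_random_measure_xsection (A : set (Omega * G)) :
  measurable A -> measurable_fun [set: Omega] (fun w => xi w (xsection A w)).
Proof.
move=> mA; have [K [cK clK KT]] := lcsc_compact_cover G.
have mK n : measurable (K n) by exact: lcsc_closed_measurable.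
pose D := seqDU K.
have mD n : measurable (D n).
  apply: measurableD => //; rewrite -bigcup_mkord.
  exact: bigcup_measurable.
rewrite (_ : (fun w => _) =
    (fun w => \sum_(n <oo) mrestr (xi w) (mD n) (xsection A w))); last first.
  apply/funext => w.
  rewrite -[in LHS](setIT (xsection A w)) -KT seqDU_bigcup_eq setI_bigcupr.
  rewrite measure_bigcup//=.
  - by apply: eq_eseriesl => n; exact/mem_set.
  - by move=> n _; apply: measurableI => //; exact: measurable_xsection.
  - exact/trivIset_setIl/trivIset_seqDU.
apply: ge0_emeasurable_sum => // n _.
have := @measurable_prod_subset_xsection_kernel _ _ _ _ _
  random_measure_kernel (D n) (mD n).
case/(_ _ A mA) => // w.
have xiD : xi w (D n) < +oo.
  rewrite (le_lt_trans _ (lfmeasure_locally_finite (xi w) (cK n)))//.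
  by rewrite le_measure ?inE//; exact: subset_seqDU.
exists (fine (xi w (D n)) + 1)%R => X mX.
rewrite EFinD fineK ?ge0_fin_numE// (@le_lt_trans _ _ (xi w (D n)))//.
  by rewrite /mrestr le_measure ?inE//; exact: measurableI.
by rewrite lteDl ?lte01// ge0_fin_numE.
Qed.

Lemma measurable_random_measure_integral (f : Omega * G -> \bar R) :
  (forall x, 0 <= f x) -> measurable_fun [set: Omega * G] f ->
  measurable_fun [set: Omega] (fun w => \int[xi w]_s f (w, s)).
Proof.
move=> f0 mf; pose f_ := nnsfun_approx measurableT mf.
apply: (@measurable_fun_xsection_integral _ _ _ _ _ f (fun w => xi w) f_).
- by move=> a b ab; exact/nd_nnsfun_approx.
- by move=> z; exact/cvg_nnsfun_approx.
- by move=> n r; exact: measurable_random_measure_xsection.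
Qed.

End random_measure_integral.

Section palm.
Local Open Scope ereal_scope.
Context d (G : lcscGroupType) (Omega : measurableType d) (R : realType).
Variables (theta : measurable_flow G Omega).
Variables (lambda : {measure set G -> \bar R}).
Variables (P : {measure set Omega -> \bar R}).
Variables (xi : random_measure Omega G R).
Variables (B : set G).

(* The Palm measure of xi computed with the test set B, to be used with
   0 < lambda B < +oo. The argument mB only serves to attach to palm its
   structure of measure, see palm_measure *)
Definition palm (mB : measurable B) (A : set Omega) : \bar R :=
  ((fine (lambda B))^-1)%:E *
  \int[P]_w \int[xi w]_s ((\1_A (theta s w))%:E * (\1_B s)%:E).

Hypothesis mB : measurable B.

Let lambdaV_ge0 : 0 <= ((fine (lambda B))^-1)%:E :> \bar R.
Proof. by rewrite lee_fin invr_ge0 fine_ge0. Qed.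

Let f (A : set Omega) (x : Omega * G) : \bar R :=
  (\1_A (theta x.2 x.1))%:E * (\1_B x.2)%:E.

Let f_ge0 A x : 0 <= f A x.
Proof. by rewrite /f -EFinM lee_fin mulr_ge0. Qed.

Let measurable_f A : measurable A -> measurable_fun setT (f A).
Proof.
move=> mA; apply: emeasurable_funM.
- apply/measurable_EFinP.
  apply: (@measurableT_comp _ _ _ _ _ _ (\1_A : Omega -> R)) => //.
  exact: measurable_flow_map.
- apply/measurable_EFinP.
  exact: (@measurableT_comp _ _ _ _ _ _ (\1_B : G -> R)).
Qed.

Let palm0 : palm mB set0 = 0.
Proof.
rewrite /palm integral0_eq ?mule0// => w _.
by rewrite integral0_eq// => s _; rewrite indic0 mul0e.
Qed.

Let palm_ge0 A : 0 <= palm mB A.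
Proof.
by apply: mule_ge0 => //; apply: integral_ge0 => w _; apply: integral_ge0 => s _;
  exact: (f_ge0 A (w, s)).
Qed.

Let palm_sigma_additive : semi_sigma_additive (palm mB).
Proof.
move=> F mF tF mUF; rewrite /palm.
have mfw A w : measurable A -> measurable_fun [set: G] (fun s => f A (w, s)).
  by move=> mA; exact: measurableT_comp (measurable_f mA) (measurable_pair1 w).
have -> : \int[P]_w \int[xi w]_s f (\bigcup_n F n) (w, s) =
          \sum_(n <oo) \int[P]_w \int[xi w]_s f (F n) (w, s).
  rewrite -integral_nneseries//; last 2 first.
  - move=> n; apply: measurable_random_measure_integral => //.
    exact: measurable_f.
  - by move=> n w _; apply: integral_ge0 => s _; exact: f_ge0.
  apply: eq_integral => w _.
  rewrite -integral_nneseries//; last first.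
    by move=> n; exact: mfw.
  apply: eq_integral => s _; rewrite /f/=.
  have := measure_semi_bigcup (\d_(theta s w) : {measure set Omega -> \bar R})
    mF tF mUF.
  rewrite /= diracE -indicE /dirac => ->.
  under [in RHS]eq_eseriesr do rewrite muleC.
  rewrite nneseriesZl//.
  exact: muleC.
rewrite -nneseriesZl//; last first.
  by move=> n _; apply: integral_ge0 => w _; apply: integral_ge0 => s _;
    exact: f_ge0.
apply/cvg_closeP; split; last by rewrite closeE.
apply: is_cvg_nneseries => n _ _; exact: palm_ge0.
Qed.

HB.instance Definition _ := isMeasure.Build _ _ R (palm mB)
  palm0 palm_ge0 palm_sigma_additive.

Definition palm_measure : {measure set Omega -> \bar R} := palm mB.

End palm.

(* Main.v *)
Require Import Defs.
From HB Require Import structures.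
From mathcomp Require Import all_boot all_order all_algebra.
From mathcomp Require Import all_classical all_reals all_analysis.
From mathcomp Require Import measurable_realfun.

(** The mass that xi sends along T from s to t is the mass that eta sends along
    T* from t to s, so both sides count the same pairs (s, t); they differ in
    which end of the pair is placed at the origin and in which end is localized
    in the test set of the Palm measure. Write E for the integral against P.

    By definition of the Palm measure and invariance of T, lambda B times the
    left-hand side is
      E \int \int h(theta_t w, s - t) 1_B(s) T(w, s, dt) xi(w, ds),
    where the test set B sits at the starting point s. The exchange hypothesis,
    extended from indicators to nonnegative functions ([exchange_transport]),
    turns this into an integral against T* and eta, which by invariance of T* has
    the form
      E \int u(theta_t w, t) eta(w, dt),
      u(w, r) = \int h(w, s) 1_B(s + r) T*(w, 0, ds).

    It remains to move the localization from s to t. By stationarity, the image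
    of eta(w, dt) P(dw) under the map taking (w, t) to (theta_t w, t) is the
    product of the Palm measure of eta and the Haar measure. The form of this
    fact that is needed is [campbell_averaging], which gives
      lambda B' * E \int u(theta_t w, t) eta(w, dt)
        = E \int 1_B'(t) (\int u(theta_t w, r) lambda(dr)) eta(w, dt).
    Finally \int 1_B(s + r) lambda(dr) = lambda B for all s, so that the inner
    integral is lambda B times the right-hand integrand at theta_t w, and the
    factors lambda B and lambda B' cancel.

    The proof of [campbell_averaging] uses that the Haar measure of an abelian
    group is invariant under reflection ([haar_reflection]). *)

Set Implicit Arguments.
Unset Strict Implicit.
Unset Printing Implicit Defensive.
Import Order.TTheory GRing.Theory Num.Theory.

Local Open Scope classical_set_scope.
Local Open Scope ring_scope.
Local Open Scope ereal_scope.

(** * Borel structure of the group *)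

(** Second countability is what makes the Borel sets of the product topology
    belong to the product of the Borel sigma-fields: an open set of G x G is a
    countable union of rectangles with sides in a countable basis. The
    measurability of the group operations rests on it. *)
Lemma measurable_open_prod (G : lcscGroupType) (U : set (G * G)) :
  open U -> measurable U.
Proof.
move=> oU; have [V cV [oV bV]] := @lcsc_second_countable G.
pose I := [set p : set G * set G | [/\ V p.1, V p.2 & p.1 `*` p.2 `<=` U]].
have -> : U = \bigcup_(p in I) (p.1 `*` p.2).
  apply/seteqP; split=> [[x y] Uxy|z [p [_ _ pU] pz]]; last exact: pU.
  have [[A B]/= [nA nB] ABU] := open_nbhs_nbhs (conj oU Uxy).
  have [A' [VA' A'x] A'A] := bV x A nA.
  have [B' [VB' B'y] B'B] := bV y B nB.
  exists (A', B') => //; split=> //= -[a b] [/= /A'A ? /B'B ?].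
  exact: ABU.
have cI : countable I.
  apply: (@sub_countable _ _ _ (V `*` V)); last exact: countableX.
  by apply: subset_card_le => p [].
have [->|[f]] := pfcard_geP cI; first by rewrite bigcup_set0.
rewrite -(image_eq f) bigcup_image.
apply: bigcup_measurable => n _.
have [V1 V2 _] : I (f n) by apply: funS.
by apply: measurableX; apply: sub_sigma_algebra; exact: oV.
Qed.

Lemma measurable_fun_sub (G : lcscGroupType) d (X : measurableType d)
    (f g : X -> G) :
  measurable_fun setT f -> measurable_fun setT g ->
  measurable_fun setT (fun x => f x - g x)%R.
Proof.
move=> mf mg.
have ms : measurable_fun [set: G * G] (fun z => z.1 - z.2)%R.
  apply: (measurability (@open G)) => // _ [U oU <-].
  rewrite setTI; apply: measurable_open_prod.
  by move/continuousP : (@sub_continuous G); apply.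
exact: (measurableT_comp ms (measurable_fun_pair mf mg)).
Qed.

Lemma measurable_fun_opp (G : lcscGroupType) d (X : measurableType d)
    (f : X -> G) :
  measurable_fun setT f -> measurable_fun setT (fun x => - f x)%R.
Proof.
by move=> mf; under eq_fun do rewrite -sub0r; exact: measurable_fun_sub.
Qed.

Lemma measurable_fun_add (G : lcscGroupType) d (X : measurableType d)
    (f g : X -> G) :
  measurable_fun setT f -> measurable_fun setT g ->
  measurable_fun setT (fun x => f x + g x)%R.
Proof.
move=> mf mg; rewrite (_ : (fun _ => _) = fun x => (f x - (0 - g x)))%R.
  by apply: measurable_fun_sub => //; apply: measurable_fun_sub.
by apply/funext => x; rewrite sub0r opprK.
Qed.

Lemma measurable_fun_flow d dX (G : lcscGroupType) (Omega : measurableType d)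
    (theta : measurable_flow G Omega) (X : measurableType dX)
    (s : X -> G) (w : X -> Omega) :
  measurable_fun setT s -> measurable_fun setT w ->
  measurable_fun setT (fun x => theta (s x) (w x)).
Proof.
move=> ms mw.
exact: (measurableT_comp (measurable_flow_map theta)
  (measurable_fun_pair mw ms)).
Qed.

Lemma locally_finite_sigma_finite (R : realType) (G : lcscGroupType)
  (mu : {measure set G -> \bar R}) : locally_finite mu -> sigma_finite setT mu.
Proof.
move=> lf; have [K [cK clK KT]] := lcsc_compact_cover G.
exists K => [|n]; first by rewrite KT.
by split; [exact: lcsc_closed_measurable|exact: lf].
Qed.

(** * Nonnegative measurable functions *)

Definition nneg_mfun d (X : measurableType d) (R : realType)
    (f : X -> \bar R) := (forall x, 0 <= f x) /\ measurable_fun setT f.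

Section nneg_mfun.
Context d (X : measurableType d) (R : realType).
Implicit Types f g : X -> \bar R.

Lemma nneg_mfun_cst (k : \bar R) : 0 <= k -> nneg_mfun (fun _ : X => k).
Proof. by move=> k0; split=> // x; exact: measurable_cst. Qed.

Lemma nneg_mfun_indic (A : set X) : measurable A ->
  nneg_mfun (fun x => (\1_A x)%:E : \bar R).
Proof. by move=> mA; split=> [x|]; [rewrite lee_fin|exact/measurable_EFinP]. Qed.

Lemma nneg_mfunD f g : nneg_mfun f -> nneg_mfun g ->
  nneg_mfun (fun x => f x + g x).
Proof.
by move=> [f0 mf] [g0 mg]; split=> [x|];
  [exact: adde_ge0|exact: emeasurable_funD].
Qed.

Lemma nneg_mfunM f g : nneg_mfun f -> nneg_mfun g ->
  nneg_mfun (fun x => f x * g x).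
Proof.
by move=> [f0 mf] [g0 mg]; split=> [x|];
  [exact: mule_ge0|exact: emeasurable_funM].
Qed.

End nneg_mfun.

Lemma nneg_mfun_comp d1 d2 (X : measurableType d1) (Y : measurableType d2)
    (R : realType) (f : Y -> \bar R) (phi : X -> Y) :
  nneg_mfun f -> measurable_fun setT phi -> nneg_mfun (fun x => f (phi x)).
Proof. by move=> [f0 mf] mphi; split=> //; exact: measurableT_comp. Qed.

Lemma nneg_integralZl d (X : measurableType d) (R : realType)
    (m : {measure set X -> \bar R}) (k : \bar R) (f : X -> \bar R) :
  0 <= k -> nneg_mfun f -> \int[m]_x (k * f x) = k * \int[m]_x f x.
Proof. by move=> k0 [f0 mf]; rewrite ge0_integralZl. Qed.

Lemma nneg_integralZr d (X : measurableType d) (R : realType)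
    (m : {measure set X -> \bar R}) (k : \bar R) (f : X -> \bar R) :
  0 <= k -> nneg_mfun f -> \int[m]_x (f x * k) = (\int[m]_x f x) * k.
Proof.
move=> k0 nf; rewrite muleC -nneg_integralZl//.
by under eq_integral do rewrite muleC.
Qed.

Lemma fubini_nneg d1 d2 (X : measurableType d1) (Y : measurableType d2)
    (R : realType) (m1 : {measure set X -> \bar R})
    (m2 : {measure set Y -> \bar R}) (f : X -> Y -> \bar R) :
  sigma_finite setT m1 -> sigma_finite setT m2 ->
  nneg_mfun (fun z => f z.1 z.2) ->
  \int[m1]_x \int[m2]_y f x y = \int[m2]_y \int[m1]_x f x y.
Proof.
move=> s1 s2 [f0 mf].
pose H1 := isSFinite.Build _ _ _ _ (sfinite_measure_sigma_finite s1).
pose H2 := isSFinite.Build _ _ _ _ (sfinite_measure_sigma_finite s2).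
pose M1 : {sfinite_measure set X -> \bar R} :=
  HB.pack_for (SFiniteMeasure.type X R) (Measure.sort m1) H1.
pose M2 : {sfinite_measure set Y -> \bar R} :=
  HB.pack_for (SFiniteMeasure.type Y R) (Measure.sort m2) H2.
exact: (sfinite_Fubini M1 M2 (fun z => f z.1 z.2)).
Qed.

(** All the invariance hypotheses (of the Haar measure, of random measures, of
    transport kernels) equate a measure of translated sets with a measure of the
    original sets; this is their common form under the integral sign. *)
Lemma integral_translate (R : realType) (G : lcscGroupType)
    (mu nu : {measure set G -> \bar R}) (s : G) :
  (forall B : set G, measurable B -> nu (translate B s) = mu B) ->
  forall f : G -> \bar R, measurable_fun setT f -> (forall x, 0 <= f x) ->
  \int[nu]_x f x = \int[mu]_x f (x - s)%R.
Proof.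
move=> h f mf f0.
have ms : measurable_fun [set: G] (fun x : G => x - s)%R.
  by apply: measurable_fun_sub.
rewrite (@eq_measure_integral _ _ _ _ (pushforward mu (fun x : G => x - s)%R)).
  by rewrite ge0_integral_pushforward.
move=> A mA _.
rewrite -[RHS]/(mu ((fun x : G => x - s)%R @^-1` A)) -h.
  congr (nu _); apply/seteqP; split=> [x Ax|_ [x Ax <-]] //.
  by exists (x + s)%R; rewrite /= ?addrK.
by rewrite -[X in measurable X]setTI; apply: ms.
Qed.

(** * Daniell functionals *)

(** The properties of an integral from which the standard extension argument,
    from indicators to nonnegative measurable functions, proceeds. Iterated
    integrals have them too, so that two such expressions can be compared
    without first building the measures which they represent. *)
Record daniell d (X : measurableType d) (R : realType)
    (L : (X -> \bar R) -> \bar R) : Prop := Daniell {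
  daniellZ : forall (k : R) f, (0 <= k)%R -> nneg_mfun f ->
    L (fun x => k%:E * f x) = k%:E * L f ;
  daniellD : forall f g, nneg_mfun f -> nneg_mfun g ->
    L (fun x => f x + g x) = L f + L g ;
  daniell_lim : forall f : (X -> \bar R)^nat, (forall n, nneg_mfun (f n)) ->
    (forall x, {homo f^~ x : m n / (m <= n)%N >-> m <= n}) ->
    L (fun x => limn (f^~ x)) = limn (fun n => L (f n)) }.

Section daniell.
Import HBNNSimple.
Context d (X : measurableType d) (R : realType).
Implicit Types (L : (X -> \bar R) -> \bar R) (f : X -> \bar R).

(** Linearity settles simple functions, written in canonical form, and the
    monotone limit property then settles the increasing limits of simple
    functions. *)
Lemma daniell_ext L1 L2 : daniell L1 -> daniell L2 ->
  (forall A, measurable A ->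
    L1 (fun x => (\1_A x)%:E) = L2 (fun x => (\1_A x)%:E)) ->
  forall f, nneg_mfun f -> L1 f = L2 f.
Proof.
move=> D1 D2 L12 f [f0 mf].
have L0 L : daniell L -> L (cst 0) = 0.
  move=> D; have := daniellZ D (lexx 0%R) (nneg_mfun_cst _ (lexx 0)).
  by under eq_fun do rewrite mul0e; rewrite mul0e.
have Lsum L (s : seq R) (F : R -> set X) : daniell L ->
    (forall r, measurable (F r)) -> (forall r, r \in s -> (0 <= r)%R) ->
    nneg_mfun (fun x => \sum_(r <- s) r%:E * (\1_(F r) x)%:E) /\
    L (fun x => \sum_(r <- s) r%:E * (\1_(F r) x)%:E) =
    \sum_(r <- s) r%:E * L (fun x => (\1_(F r) x)%:E).
  move=> D mF; elim: s => [|r s IH] s0.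
    under eq_fun do rewrite big_nil.
    by rewrite big_nil; split; [exact: nneg_mfun_cst|exact: L0].
  have [r' rs|Hs IHs] := IH; first by apply: s0; rewrite inE rs orbT.
  have r0 : (0 <= r)%R by apply: s0; rewrite inE eqxx.
  have Hr : nneg_mfun (fun x => r%:E * (\1_(F r) x)%:E).
    by apply: nneg_mfunM; [exact: nneg_mfun_cst|exact: nneg_mfun_indic].
  under eq_fun do rewrite big_cons.
  rewrite big_cons; split; first exact: nneg_mfunD.
  by rewrite (daniellD D)// (daniellZ D)// ?IHs//; exact: nneg_mfun_indic.
have Lnn (h : {nnsfun X >-> R}) :
    L1 (fun x => (h x)%:E) = L2 (fun x => (h x)%:E).
  (* A negative r has an empty fibre; dropping it keeps all coefficients of the
     canonical form of h nonnegative. *)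
  pose s := [seq r <- finmap.enum_fset (fset_set (range h)) | (0 <= r)%R].
  have -> : (fun x => (h x)%:E) =
      (fun x => \sum_(r <- s) r%:E * (\1_(h @^-1` [set r]) x)%:E).
    apply/funext => x; rewrite fimfunE fsbig_finite//= sumEFin big_filter.
    congr EFin; rewrite [RHS]big_mkcond/=; apply: eq_bigr => r _.
    case: ifPn => //; rewrite -ltNge => r0; rewrite indicE.
    rewrite memNset ?mulr0//= => hxr.
    by have : (0 <= h x)%R by []; rewrite hxr leNgt r0.
  have s0 r : r \in s -> (0 <= r)%R by rewrite mem_filter => /andP[].
  have mh r : measurable (h @^-1` [set r]) by exact: measurable_sfunP.
  rewrite (Lsum _ _ _ D1 mh s0).2 (Lsum _ _ _ D2 mh s0).2.
  by apply: eq_bigr => r _; rewrite L12.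
pose h := nnsfun_approx measurableT mf.
have hn n : nneg_mfun (fun x => (h n x)%:E).
  by split=> [x|]; [rewrite lee_fin|exact/measurable_EFinP].
have nh x : {homo (fun n => (h n x)%:E) : m n / (m <= n)%N >-> m <= n}.
  by move=> m n mn; rewrite lee_fin; exact/lefP/nd_nnsfun_approx.
have -> : f = (fun x => limn (fun n => (h n x)%:E)).
  by apply/funext => x; apply/esym/cvg_lim => //; exact: cvg_nnsfun_approx.
rewrite (daniell_lim D1 hn nh) (daniell_lim D2 hn nh).
by congr (limn _); apply/funext => n; exact: Lnn.
Qed.

Lemma daniell_integral (m : {measure set X -> \bar R}) :
  daniell (fun f => \int[m]_x f x).
Proof.
split.
- by move=> k f k0 [f0 mf]; rewrite ge0_integralZl.
- by move=> f g [f0 mf] [g0 mg]; rewrite ge0_integralD.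
- move=> f nf ndf; rewrite monotone_convergence//.
  + by move=> n; have [] := nf n.
  + by move=> n x _; have [->] := nf n.
Qed.

End daniell.

(** * Locally finite kernels *)

(** Random measures and weighted transport-kernels in one form, with an arbitrary
    measurable space as source so that either may be composed with a measurable
    change of parameter. *)
Record lf_kernel d (X : measurableType d) (G : lcscGroupType) (R : realType)
    (k : X -> {measure set G -> \bar R}) : Prop := LfKernel {
  lf_kernel_lf : forall x, locally_finite (k x) ;
  lf_kernel_measurable : forall B, measurable B ->
    measurable_fun setT (fun x => k x B) }.

Lemma random_measure_lf_kernel d (Omega : measurableType d) (G : lcscGroupType)
    (R : realType) (xi : random_measure Omega G R) :
  lf_kernel (fun w => xi w : {measure set G -> \bar R}).
Proof.
by split=> [w|B mB];
  [exact: lfmeasure_locally_finite|exact: measurable_random_measure].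
Qed.

Lemma kernel_lf_kernel d (Omega : measurableType d) (G : lcscGroupType)
    (R : realType) (T : R.-ker (Omega * G) ~> G) :
  weighted_transport_kernel T -> lf_kernel (fun x => T x).
Proof. by move=> lT; split=> // B mB; exact: measurable_kernel. Qed.

Lemma lf_kernel_comp d d' (X : measurableType d) (Y : measurableType d')
    (G : lcscGroupType) (R : realType) (k : Y -> {measure set G -> \bar R})
    (phi : X -> Y) :
  lf_kernel k -> measurable_fun setT phi -> lf_kernel (fun x => k (phi x)).
Proof.
move=> [lk mk] mphi; split=> [x|B mB]; first exact: lk.
exact: (measurableT_comp (mk B mB)).
Qed.

Lemma lf_kernel_random_measure d (X : measurableType d) (G : lcscGroupType)
    (R : realType) (k : X -> {measure set G -> \bar R}) :
  lf_kernel k -> exists xi : random_measure X G R,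
    forall x, xi x = k x :> {measure set G -> \bar R}.
Proof.
case=> lk mk.
pose xi x : lfmeasure G R := LFMeasure (lk x).
have mxi : measurable_fun setT xi.
  apply: (measurability (@lfmeasure_ev_preimages G R)) => //.
  move=> _ [_ [B mB [C mC <-]] <-].
  rewrite !setTI.
  by have := mk B mB measurableT C mC; rewrite setTI.
by exists (HB.pack_for (random_measure X G R) xi
  (isMeasurableFun.Build _ _ _ _ _ mxi)).
Qed.

(** Packing the kernel as a random measure over its source space reduces the
    measurability of parametric integrals to the case of random measures. *)
Lemma lf_kernel_integral d (X : measurableType d) (G : lcscGroupType)
    (R : realType) (k : X -> {measure set G -> \bar R}) (f : X -> G -> \bar R) :
  lf_kernel k -> nneg_mfun (fun z : X * G => f z.1 z.2) ->
  nneg_mfun (fun x => \int[k x]_s f x s).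
Proof.
move=> /lf_kernel_random_measure[xi xiE] [f0 mf]; split=> [x|].
  by apply: integral_ge0 => s _; exact: (f0 (x, s)).
under eq_fun do rewrite -xiE.
exact: (measurable_random_measure_integral xi f0 mf).
Qed.

(** The map [phi] and the weight [g] make room for the flow and the test set in
    the definition of the Palm measure, and for a change of the order of the two
    coordinates. *)
Lemma daniell_iterated d dY (X : measurableType d) (Y : measurableType dY)
    (G : lcscGroupType) (R : realType) (m : {measure set X -> \bar R})
    (k : X -> {measure set G -> \bar R}) (phi : X -> G -> Y)
    (g : X -> G -> R) :
  lf_kernel k -> measurable_fun setT (fun z : X * G => phi z.1 z.2) ->
  nneg_mfun (fun z : X * G => (g z.1 z.2)%:E) ->
  daniell (fun f : Y -> \bar R =>
    \int[m]_x \int[k x]_s (f (phi x s) * (g x s)%:E)).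
Proof.
move=> kk mphi ng.
have nn f : nneg_mfun f ->
    nneg_mfun (fun z : X * G => f (phi z.1 z.2) * (g z.1 z.2)%:E).
  by move=> nf; apply: nneg_mfunM => //; exact: (nneg_mfun_comp nf).
have nk f : nneg_mfun f ->
    nneg_mfun (fun x => \int[k x]_s (f (phi x s) * (g x s)%:E)).
  by move=> /nn; exact: lf_kernel_integral.
have nx f x : nneg_mfun f ->
    nneg_mfun (fun s => f (phi x s) * (g x s)%:E).
  by move=> /nn nf; exact: (nneg_mfun_comp nf (measurable_pair1 x)).
split.
- move=> c f c0 nf; rewrite -(daniellZ (daniell_integral m))//; last exact: nk.
  apply: eq_integral => x _; rewrite -(daniellZ (daniell_integral (k x)))//;
    last exact: nx.
  by apply: eq_integral => s _; rewrite muleA.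
- move=> f f' nf nf'; rewrite -(daniellD (daniell_integral m))//; [|exact: nk..].
  apply: eq_integral => x _; rewrite -(daniellD (daniell_integral (k x)))//;
    [|exact: nx..].
  by apply: eq_integral => s _; rewrite ge0_muleDl//; [apply nf.1|apply nf'.1].
- move=> f nf ndf.
  have ndx x s i j : (i <= j)%N ->
      f i (phi x s) * (g x s)%:E <= f j (phi x s) * (g x s)%:E.
    by move=> ij; rewrite lee_wpmul2r//; [exact: (ng.1 (x, s))|exact: ndf].
  rewrite -(daniell_lim (daniell_integral m)) => [|n|x n n' nn'].
  + apply: eq_integral => x _.
    rewrite -(daniell_lim (daniell_integral (k x))) => [|n|s];
      [|exact: nx|exact: ndx].
    apply: eq_integral => s _.
    rewrite limeMr//; apply: ereal_nondecreasing_is_cvgn.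
    by move=> n n' nn'; exact: ndf.
  + exact: nk.
  + have [n0 mn0] := nx _ x (nf n). have [n1 mn1] := nx _ x (nf n').
    by apply: ge0_le_integral => // s _; exact: ndx.
Qed.

(** * Reflection invariance of the Haar measure *)

Lemma pmule_inj (R : realType) (x a b : \bar R) :
  0 < x -> x < +oo -> x * a = x * b -> a = b.
Proof.
move=> x0 xoo xab; have xfin : x \is a fin_num by rewrite ge0_fin_numE// ltW.
have xn0 : x != 0 by rewrite gt_eqF.
by rewrite -[a]mul1e -[b]mul1e -(mulVe xn0 xfin) -!muleA xab.
Qed.

Section haar.
Context (R : realType) (G : lcscGroupType).
Variable lambda : {measure set G -> \bar R}.
Hypothesis lambda_haar : haar_measure lambda.

Lemma haar_sigma_finite : sigma_finite setT lambda.
Proof. by apply: locally_finite_sigma_finite; case: lambda_haar. Qed.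

Lemma haar_integralD (f : G -> \bar R) (s : G) : nneg_mfun f ->
  \int[lambda]_x f (x + s)%R = \int[lambda]_x f x.
Proof.
move=> [f0 mf]; have [_ _ inv] := lambda_haar.
rewrite (@integral_translate _ _ _ _ (- s)%R (inv (- s)%R) f mf f0).
by apply: eq_integral => x _; rewrite opprK.
Qed.

Variables (B : set G).
Hypotheses (mB : measurable B) (B_gt0 : 0 < lambda B) (B_fin : lambda B < +oo).

(** By Fubini and translation invariance
      lambda A * lambda B = \int \int 1_A(x) 1_B(y + x) dy dx
        = \int \int 1_A(x - y) 1_B(x) dx dy = lambda B * \int 1_A(- y) dy,
    and the finite positive factor lambda B cancels. *)
Lemma haar_reflection (A : set G) : measurable A ->
  \int[lambda]_x (\1_A (- x)%R)%:E = lambda A.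
Proof.
move=> mA.
have nA := @nneg_mfun_indic _ G R A mA.
have nB := @nneg_mfun_indic _ G R B mB.
have intI C : measurable C -> \int[lambda]_x (\1_C x)%:E = lambda C.
  by move=> mC; rewrite integral_indic// setIT.
suff H : lambda B * lambda A = lambda B * \int[lambda]_x (\1_A (- x)%R)%:E.
  by apply/esym; exact: (pmule_inj B_gt0 B_fin).
transitivity (\int[lambda]_x \int[lambda]_y
    ((\1_A x)%:E * (\1_B (y + x)%R)%:E)).
  rewrite -[in LHS](intI A mA) -nneg_integralZl//.
  apply: eq_integral => x _; rewrite nneg_integralZl ?lee_fin//; last first.
    by apply: (nneg_mfun_comp nB); exact: measurable_fun_add.
  by rewrite (haar_integralD x nB) intI// muleC.
rewrite fubini_nneg; [|exact: haar_sigma_finite..|]; last first.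
  apply: nneg_mfunM; first exact: (nneg_mfun_comp nA).
  by apply: (nneg_mfun_comp nB); exact: measurable_fun_add.
transitivity (\int[lambda]_y \int[lambda]_x
    ((\1_A (x - y)%R)%:E * (\1_B x)%:E)).
  apply: eq_integral => y _.
  rewrite -[LHS](haar_integralD (- y)%R); last first.
    apply: nneg_mfunM => //.
    by apply: (nneg_mfun_comp nB); exact: measurable_fun_add.
  by apply: eq_integral => x _; rewrite /= addrCA subrr addr0.
rewrite fubini_nneg; [|exact: haar_sigma_finite..|]; last first.
  apply: nneg_mfunM; last exact: (nneg_mfun_comp nB).
  by apply: (nneg_mfun_comp nA); exact: measurable_fun_sub.
rewrite -[in RHS](intI B mB) -nneg_integralZr//; last first.
  by apply: integral_ge0 => x _; rewrite lee_fin.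
apply: eq_integral => x _; rewrite nneg_integralZr ?lee_fin//; last first.
  by apply: (nneg_mfun_comp nA); exact: measurable_fun_sub.
rewrite muleC; congr (_ * _); rewrite -[LHS](haar_integralD x); last first.
  by apply: (nneg_mfun_comp nA); exact: measurable_fun_sub.
by apply: eq_integral => y _; rewrite /= opprD addrCA subrr addr0.
Qed.

Lemma haar_reflectionD (A : set G) (t : G) : measurable A ->
  \int[lambda]_r (\1_A (t - r)%R)%:E = lambda A.
Proof.
move=> mA; rewrite -[LHS](haar_integralD t); last first.
  by apply: (nneg_mfun_comp (nneg_mfun_indic _ mA)); exact: measurable_fun_sub.
rewrite -[RHS]haar_reflection//; apply: eq_integral => r _.
by rewrite /= opprD addrCA subrr addr0.
Qed.

End haar.

(** * Palm measures and stationarity *)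

Section palm.
Context d (G : lcscGroupType) (Omega : measurableType d) (R : realType).
Variables (lambda : {measure set G -> \bar R}).
Hypothesis lambda_haar : haar_measure lambda.
Variables (theta : measurable_flow G Omega).
Variables (P : {measure set Omega -> \bar R}) (xi : random_measure Omega G R).

(** Both sides are Daniell functionals of f, and on indicators the identity is the
    definition of the Palm measure. Keeping lambda B on the left avoids inverses
    in the sequel. *)
Lemma integral_palm (B : set G) (mB : measurable B) (f : Omega -> \bar R) :
  0 < lambda B -> lambda B < +oo -> nneg_mfun f ->
  lambda B * \int[palm_measure theta lambda P xi mB]_w f w =
  \int[P]_w \int[xi w]_s (f (theta s w) * (\1_B s)%:E).
Proof.
move=> B0 Boo nf.
have Bfin : lambda B \is a fin_num by rewrite ge0_fin_numE.
have c0 : (0 <= fine (lambda B))%R by rewrite fine_ge0.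
pose m := mscale (NngNum c0) (palm_measure theta lambda P xi mB).
transitivity (\int[m]_w f w).
  by case: nf => f0 mf; rewrite ge0_integral_mscale//= fineK.
move: f nf; apply: daniell_ext; first exact: daniell_integral.
  apply: daniell_iterated; first exact: random_measure_lf_kernel.
    by apply: measurable_fun_flow.
  exact: (nneg_mfun_comp (nneg_mfun_indic R mB)).
move=> A mA; rewrite integral_indic// setIT /m/= /mscale/= /palm muleA -EFinM.
by rewrite divff ?mul1e// gt_eqF// fine_gt0// B0.
Qed.

Hypothesis P_sigma_finite : sigma_finite setT P.
Hypothesis P_stationary : stationary theta P.
Hypothesis xi_inv : invariant_random_measure theta xi.

Lemma stationary_integral (s : G) (f : Omega -> \bar R) : nneg_mfun f ->
  \int[P]_w f (theta s w) = \int[P]_w f w.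
Proof.
move=> [f0 mf].
have ms : measurable_fun setT (theta s) by apply: measurable_fun_flow.
transitivity (\int[pushforward P (theta s)]_w f w).
  by rewrite ge0_integral_pushforward.
by apply: eq_measure_integral => A mA _; exact: P_stationary.
Qed.

(** The image of xi(w, dt) P(dw) under the map taking (w, t) to (theta_t w, t) is
    invariant under shifts of the second coordinate: replacing w by its image under
    theta_(-r), which preserves P, moves every point t of xi to t + r and leaves
    theta_t w unchanged. *)
Lemma integral_random_measure_flow (r : G) (f : Omega -> G -> \bar R) :
  nneg_mfun (fun z => f z.1 z.2) ->
  \int[P]_w \int[xi w]_t f (theta t w) t =
  \int[P]_w \int[xi w]_t f (theta t w) (t + r)%R.
Proof.
move=> nf.
have nf' : nneg_mfun (fun z : Omega * G => f (theta z.2 z.1) z.2).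
  apply: (nneg_mfun_comp nf (phi := fun z => (theta z.2 z.1, z.2))).
  by apply: measurable_fun_pair => //; exact: measurable_fun_flow.
rewrite -(stationary_integral (- r)%R); last first.
  exact: (lf_kernel_integral (f := fun w t => f (theta t w) t)
    (random_measure_lf_kernel xi)).
apply: eq_integral => w _.
have [f0 mf] := nneg_mfun_comp nf' (measurable_pair1 (theta (- r)%R w)).
rewrite (integral_translate (xi_inv w (- r)%R) mf f0).
by apply: eq_integral => t _; rewrite /= opprK flowD addrK.
Qed.

Variables (B : set G) (mB : measurable B).
Hypotheses (B_gt0 : 0 < lambda B) (B_fin : lambda B < +oo).

(** Since the position t is uniformly spread, it may be replaced by a position r
    integrated against lambda, at the price of localizing t in B. To see this,
    write lambda B as the integral of 1_B(t - r) over r, which is where the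
    reflection invariance of lambda is needed, exchange the integrals, and apply
    the shift by r to the positions. *)
Lemma campbell_averaging (g : Omega -> G -> \bar R) :
  nneg_mfun (fun z => g z.1 z.2) ->
  lambda B * \int[P]_w \int[xi w]_t g (theta t w) t =
  \int[P]_w \int[xi w]_t ((\int[lambda]_r g (theta t w) r) * (\1_B t)%:E).
Proof.
move=> ng.
have kxi := random_measure_lf_kernel xi.
have slambda := haar_sigma_finite lambda_haar.
have sxi w : sigma_finite setT (xi w).
  exact/locally_finite_sigma_finite/lfmeasure_locally_finite.
have nB := nneg_mfun_indic R mB.
have ngt d' (X : measurableType d') (w : X -> Omega) (t r : X -> G) :
    measurable_fun setT w -> measurable_fun setT t -> measurable_fun setT r ->
    nneg_mfun (fun x => g (theta (t x) (w x)) (r x)).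
  move=> mw mt mr; apply: (nneg_mfun_comp ng
    (phi := fun x => (theta (t x) (w x), r x))).
  by apply: measurable_fun_pair => //; exact: measurable_fun_flow.
have nBt d' (X : measurableType d') (t : X -> G) :
    measurable_fun setT t -> nneg_mfun (fun x => (\1_B (t x))%:E : \bar R).
  exact: (nneg_mfun_comp nB).
transitivity (\int[P]_w \int[xi w]_t \int[lambda]_r
    (g (theta t w) t * (\1_B (t - r)%R)%:E)).
  rewrite -nneg_integralZl//; last first.
    apply: (lf_kernel_integral (f := fun w t => g (theta t w) t)) => //.
    exact: ngt.
  apply: eq_integral => w _; rewrite -nneg_integralZl//; last exact: ngt.
  apply: eq_integral => t _; rewrite nneg_integralZl//.
  - by rewrite (haar_reflectionD lambda_haar mB)// muleC.
  - exact: (ng.1 (_, _)).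
  - by apply: nBt; exact: measurable_fun_sub.
transitivity (\int[lambda]_r \int[P]_w \int[xi w]_t
    (g (theta t w) t * (\1_B (t - r)%R)%:E)).
  rewrite -fubini_nneg//; last first.
    apply: (lf_kernel_integral (k := fun z : Omega * G => xi z.1)
      (f := fun z t => g (theta t z.1) t * (\1_B (t - z.2)%R)%:E)).
      exact: (lf_kernel_comp kxi).
    apply: nneg_mfunM; first by apply: ngt => //; exact: measurableT_comp.
    by apply: nBt; apply: measurable_fun_sub => //; exact: measurableT_comp.
  apply: eq_integral => w _; rewrite fubini_nneg//.
  apply: nneg_mfunM; first exact: ngt.
  by apply: nBt; exact: measurable_fun_sub.
transitivity (\int[lambda]_r \int[P]_w \int[xi w]_t
    (g (theta t w) (t + r)%R * (\1_B t)%:E)).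
  apply: eq_integral => r _.
  rewrite (integral_random_measure_flow r
    (f := fun w t => g w t * (\1_B (t - r)%R)%:E)).
    by apply: eq_integral => w _; apply: eq_integral => t _; rewrite addrK.
  apply: nneg_mfunM => //.
  by apply: nBt; exact: measurable_fun_sub.
rewrite -fubini_nneg//; last first.
  apply: (lf_kernel_integral (k := fun z : Omega * G => xi z.1)
    (f := fun z t => g (theta t z.1) (t + z.2)%R * (\1_B t)%:E)).
    exact: (lf_kernel_comp kxi).
  apply: nneg_mfunM; last exact: nBt.
  apply: ngt => //; first exact: measurableT_comp.
  by apply: measurable_fun_add => //; exact: measurableT_comp.
apply: eq_integral => w _; rewrite fubini_nneg//; last first.
  apply: nneg_mfunM; last exact: nBt.
  by apply: ngt => //; exact: measurable_fun_add.
apply: eq_integral => t _; rewrite nneg_integralZr//; last first.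
- apply: ngt => //; exact: measurable_fun_add.
under eq_integral do rewrite addrC.
rewrite (haar_integralD lambda_haar t (f := fun r => g (theta t w) r))//.
by apply: ngt => //; exact: measurable_cst.
Qed.

End palm.

(** * Transport kernels *)

Lemma integral_invariant_kernel d (G : lcscGroupType) (Omega : measurableType d)
    (R : realType) (theta : measurable_flow G Omega)
    (T : R.-ker (Omega * G) ~> G) (s : G) (w : Omega) (f : G -> \bar R) :
  invariant_kernel theta T -> nneg_mfun f ->
  \int[T (theta s w, 0%R)]_t f t = \int[T (w, s)]_t f (t - s)%R.
Proof.
move=> T_inv [f0 mf]; apply: integral_translate => // B mB.
by rewrite -(T_inv s s w B mB) subrr.
Qed.

(** For fixed w, both inner iterated integrals are Daniell functionals on G x G
    which agree on indicators, hence on the section of F at w. *)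
Lemma exchange_transport d (G : lcscGroupType) (Omega : measurableType d)
    (R : realType) (P : {measure set Omega -> \bar R})
    (xi eta : random_measure Omega G R) (T Tstar : R.-ker (Omega * G) ~> G)
    (F : Omega -> G -> G -> \bar R) :
  weighted_transport_kernel T -> weighted_transport_kernel Tstar ->
  {ae P, forall w, forall C : set (G * G), measurable C ->
      \int[xi w]_s \int[T (w, s)]_t (\1_C (s, t))%:E =
      \int[eta w]_t \int[Tstar (w, t)]_s (\1_C (s, t))%:E} ->
  nneg_mfun (fun z => F z.1.1 z.1.2 z.2) ->
  \int[P]_w \int[xi w]_s \int[T (w, s)]_t F w s t =
  \int[P]_w \int[eta w]_t \int[Tstar (w, t)]_s F w s t.
Proof.
move=> /kernel_lf_kernel kT /kernel_lf_kernel kTs TT nF.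
have kxi := random_measure_lf_kernel xi.
have keta := random_measure_lf_kernel eta.
have mF dX (X : measurableType dX) (w : X -> Omega) (s t : X -> G) :
    measurable_fun setT w -> measurable_fun setT s -> measurable_fun setT t ->
    nneg_mfun (fun x => F (w x) (s x) (t x)).
  move=> mw ms mt; apply: (nneg_mfun_comp nF (phi := fun x => (w x, s x, t x))).
  by do 2 apply: measurable_fun_pair => //.
have n1 : nneg_mfun (fun w => \int[xi w]_s \int[T (w, s)]_t F w s t).
  apply: (lf_kernel_integral (f := fun w s => \int[T (w, s)]_t F w s t) kxi).
  apply: (lf_kernel_integral (k := fun z : Omega * G => T (z.1, z.2))
    (f := fun z t => F z.1 z.2 t)).
    apply: (lf_kernel_comp kT (phi := fun z => (z.1, z.2))).
    exact: measurable_fun_pair.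
  by apply: mF => //; exact: measurableT_comp.
have n2 : nneg_mfun (fun w => \int[eta w]_t \int[Tstar (w, t)]_s F w s t).
  apply: (lf_kernel_integral (f := fun w t => \int[Tstar (w, t)]_s F w s t) keta).
  apply: (lf_kernel_integral (k := fun z : Omega * G => Tstar (z.1, z.2))
    (f := fun z s => F z.1 s z.2)).
    apply: (lf_kernel_comp kTs (phi := fun z => (z.1, z.2))).
    exact: measurable_fun_pair.
  by apply: mF => //; exact: measurableT_comp.
have [n10 mn1] := n1; have [n20 mn2] := n2.
apply: ge0_ae_eq_integral => //.
apply: filterS TT => w TTw _.
have D (k : G -> {measure set G -> \bar R}) (m : {measure set G -> \bar R})
    (phi : G -> G -> G * G) : lf_kernel k ->
    measurable_fun setT (fun z => phi z.1 z.2) ->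
    daniell (fun f : G * G -> \bar R => \int[m]_s \int[k s]_t f (phi s t)).
  move=> kk mphi.
  have := daniell_iterated m kk mphi (g := fun _ _ => 1%R)
    (nneg_mfun_cst _ lee01).
  congr daniell; apply/funext => f; apply: eq_integral => s _.
  by apply: eq_integral => t _; rewrite mule1.
have := @daniell_ext _ _ _ (fun f => \int[xi w]_s \int[T (w, s)]_t f (s, t))
  (fun f => \int[eta w]_t \int[Tstar (w, t)]_s f (s, t)).
move=> /(_ _ _ TTw (fun z => F w z.1 z.2)); apply.
- apply: (D (fun s => T (w, s)) _ (fun s t => (s, t))).
    apply: (lf_kernel_comp kT (phi := fun s => (w, s))).
    exact: measurable_fun_pair.
  exact: measurable_fun_pair.
- apply: (D (fun t => Tstar (w, t)) _ (fun t s => (s, t))).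
    apply: (lf_kernel_comp kTs (phi := fun s => (w, s))).
    exact: measurable_fun_pair.
  exact: measurable_fun_pair.
- by apply: mF => //; exact: measurable_cst.
Qed.

Theorem theorem3p6 (R : realType) (G : lcscGroupType)
    (lambda : {measure set G -> \bar R}) (lambda_haar : haar_measure lambda)
    (d : measure_display) (Omega : measurableType d)
    (theta : measurable_flow G Omega)
    (P : {sigma_finite_measure set Omega -> \bar R})
    (P_stationary : stationary theta P)
    (xi eta : random_measure Omega G R)
    (xi_inv : invariant_random_measure theta xi)
    (eta_inv : invariant_random_measure theta eta)
    (T Tstar : R.-ker (Omega * G) ~> G)
    (T_wtk : weighted_transport_kernel T)
    (Tstar_wtk : weighted_transport_kernel Tstar)
    (T_inv : invariant_kernel theta T)
    (Tstar_inv : invariant_kernel theta Tstar)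
    (T_Tstar : {ae P, forall w, forall C : set (G * G), measurable C ->
      \int[xi w]_s \int[T (w, s)]_t (\1_C (s, t))%:E =
      \int[eta w]_t \int[Tstar (w, t)]_s (\1_C (s, t))%:E})
    (B : set G) (mB : measurable B) (B_gt0 : 0 < lambda B)
    (B_fin : lambda B < +oo)
    (B' : set G) (mB' : measurable B') (B'_gt0 : 0 < lambda B')
    (B'_fin : lambda B' < +oo)
    (h : Omega * G -> R) (mh : measurable_fun [set: Omega * G] h)
    (h_ge0 : forall x, (0 <= h x)%R) :
  \int[palm_measure theta lambda P xi mB]_w
    \int[T (w, 0%R)]_t (h (theta t w, (- t)%R))%:E =
  \int[palm_measure theta lambda P eta mB']_w
    \int[Tstar (w, 0%R)]_t (h (theta 0%R w, t))%:E.
Proof.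
have sP : sigma_finite setT P by exact: sigma_finiteT.
have sigma_lambda := haar_sigma_finite lambda_haar.
have kT := kernel_lf_kernel T_wtk; have kTs := kernel_lf_kernel Tstar_wtk.
have nh dX (X : measurableType dX) (w : X -> Omega) (s t : X -> G) :
    measurable_fun setT w -> measurable_fun setT s -> measurable_fun setT t ->
    nneg_mfun (fun x => (h (theta (s x) (w x), t x))%:E).
  move=> mw ms mt; split=> [x|]; first by rewrite lee_fin.
  apply/measurable_EFinP; apply: (measurableT_comp mh).
  by apply: measurable_fun_pair => //; exact: measurable_fun_flow.
have nB dX (X : measurableType dX) (s : X -> G) : measurable_fun setT s ->
    nneg_mfun (fun x => (\1_B (s x))%:E : \bar R).
  exact: (nneg_mfun_comp (nneg_mfun_indic _ mB)).
pose lhs w := \int[T (w, 0%R)]_t (h (theta t w, (- t)%R))%:E.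
pose rhs w := \int[Tstar (w, 0%R)]_s (h (theta 0%R w, s))%:E.
(* The right-hand integrand, localized so that a transport along Tstar which
   starts at the position r ends in B. *)
pose u w r := \int[Tstar (w, 0%R)]_s
  ((h (theta 0%R w, s))%:E * (\1_B (s + r)%R)%:E).
have nlhs : nneg_mfun lhs.
  apply: (lf_kernel_integral (k := fun w => T (w, 0%R))).
    exact: (lf_kernel_comp kT).
  by apply: nh => //; exact: measurable_fun_opp.
have nrhs : nneg_mfun rhs.
  apply: (lf_kernel_integral (k := fun w => Tstar (w, 0%R))).
    exact: (lf_kernel_comp kTs).
  by apply: nh.
have nu : nneg_mfun (fun z => u z.1 z.2).
  apply: (lf_kernel_integral (k := fun z : Omega * G => Tstar (z.1, 0%R))
    (f := fun z s => (h (theta 0%R z.1, s))%:E * (\1_B (s + z.2)%R)%:E)).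
    apply: (lf_kernel_comp kTs (phi := fun z : Omega * G => (z.1, 0%R : G))).
    by apply: measurable_fun_pair => //; exact: measurable_cst.
  apply: nneg_mfunM; first by apply: nh => //; exact: measurableT_comp.
  by apply: nB; apply: measurable_fun_add => //; exact: measurableT_comp.
have key : lambda B * \int[palm_measure theta lambda P xi mB]_w lhs w =
    \int[P]_w \int[eta w]_t u (theta t w) t.
  rewrite integral_palm//.
  transitivity (\int[P]_w \int[xi w]_s \int[T (w, s)]_t
      ((h (theta t w, (s - t)%R))%:E * (\1_B s)%:E)).
    apply: eq_integral => w _; apply: eq_integral => s _.
    rewrite nneg_integralZr ?lee_fin//; last first.
      by apply: nh => //; exact: measurable_fun_sub.
    congr (_ * _); rewrite /lhs (integral_invariant_kernel _ _ T_inv); last first.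
      by apply: nh => //; exact: measurable_fun_opp.
    by apply: eq_integral => t _; rewrite flowD subrK opprB.
  rewrite (exchange_transport
    (F := fun w s t => (h (theta t w, (s - t)%R))%:E * (\1_B s)%:E)
    T_wtk Tstar_wtk T_Tstar); last first.
    apply: nneg_mfunM; last by apply: nB; exact: measurableT_comp.
    apply: nh => //; first exact: measurableT_comp.
    by apply: measurable_fun_sub => //; exact: measurableT_comp.
  apply: eq_integral => w _; apply: eq_integral => t _.
  rewrite /u (integral_invariant_kernel _ _ Tstar_inv); last first.
    apply: nneg_mfunM; first exact: nh.
    by apply: nB; exact: measurable_fun_add.
  by apply: eq_integral => s _; rewrite flow0 subrK.
apply: (pmule_inj B_gt0 B_fin); apply: (pmule_inj B'_gt0 B'_fin).
rewrite key (campbell_averaging lambda_haar sP P_stationary eta_inv mB' B'_gt0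
  B'_fin nu).
rewrite muleCA integral_palm//.
rewrite -nneg_integralZl//; last first.
  apply: (lf_kernel_integral (f := fun w t => rhs (theta t w) * (\1_B' t)%:E)).
    exact: random_measure_lf_kernel.
  apply: nneg_mfunM; last exact: (nneg_mfun_comp (nneg_mfun_indic R mB')).
  by apply: (nneg_mfun_comp nrhs); exact: measurable_fun_flow.
apply: eq_integral => w _; rewrite -nneg_integralZl//; last first.
  apply: nneg_mfunM; last exact: nneg_mfun_indic.
  by apply: (nneg_mfun_comp nrhs); exact: measurable_fun_flow.
apply: eq_integral => t _; rewrite muleA; congr (_ * _).
(* Integrating the position r against lambda removes the localization of u and
   leaves the factor lambda B, by translation invariance. *)
rewrite /u fubini_nneg//; last 2 first.
- exact/locally_finite_sigma_finite/Tstar_wtk.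
- apply: nneg_mfunM; first exact: nh.
  by apply: nB; exact: measurable_fun_add.
rewrite /rhs -nneg_integralZl//; last exact: nh.
apply: eq_integral => s _; rewrite nneg_integralZl ?lee_fin//; last first.
  by apply: nB; exact: measurable_fun_add.
rewrite muleC; congr (_ * _).
under eq_integral do rewrite addrC.
rewrite (haar_integralD lambda_haar s (nneg_mfun_indic R mB)).
by rewrite integral_indic// setIT.
Qed.
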